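(* Let $\mathbf{K}$ be a monoidal triangulated category in which every object is either left or right dualizable. If $\mathbf{K}$ has a non-zero nilpotent object $M$ (i.e., $M \not\cong 0$ but $M^{\otimes n} := M \otimes \dots \otimes M \cong 0$ for some $n > 0$), then not all prime ideals of $\mathbf{K}$ are completely prime. As a consequence, the universal support datum $V : \mathbf{K} \to \mathcal{X}(\operatorname{Spc} \mathbf{K})$ does not have the tensor product property, i.e., it is not the case that $V(A\otimes B) = V(A) \cap V(B)$ for all $A, B \in \mathbf{K}$.
   Context: A monoidal triangulated category is a monoidal category $\mathbf{K}$ which is triangulated and for which $\otimes : \mathbf{K} \times \mathbf{K} \to \mathbf{K}$ is an exact bifunctor. A thick subcategory is a full triangulated subcategory containing all direct summands of its objects. A thick two-sided ideal is a thick subcategory closed under left and right tensoring with arbitrary objects of $\mathbf{K}$. An object $A$ is left dualizable if there is an object $A^*$ with maps $\mathrm{ev}: A^* \otimes A \to 1$ and $\mathrm{coev}: 1 \to A \otimes A^*$ such that the compositions $A \to A \otimes A^* \otimes A \to A$ (given by $\mathrm{coev} \otimes \mathrm{id}$, then $\mathrm{id} \otimes \mathrm{ev}$) and $A^* \to A^* \otimes A \otimes A^* \to A^*$ (given by $\mathrm{id} \otimes \mathrm{coev}$, then $\mathrm{ev} \otimes \mathrm{id}$) are identities. Right dualizable is defined analogously, with ${}^*A$ and maps $A \otimes {}^*A \to 1$, $1 \to {}^*A \otimes A$. A prime ideal of $\mathbf{K}$ is a proper thick two-sided ideal $\mathbf{P}$ such that for all thick two-sided ideals $\mathbf{I}, \mathbf{J}$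 of $\mathbf{K}$, $\mathbf{I} \otimes \mathbf{J} \subseteq \mathbf{P}$ implies $\mathbf{I} \subseteq \mathbf{P}$ or $\mathbf{J} \subseteq \mathbf{P}$, where $\mathbf{I}\otimes\mathbf{J}$ is the collection of objects $A \otimes B$ with $A\in\mathbf{I}$, $B\in\mathbf{J}$. (Equivalently: for all $A,B\in\mathbf{K}$, if $A \otimes C \otimes B \in \mathbf{P}$ for all $C \in \mathbf{K}$, then $A \in \mathbf{P}$ or $B \in \mathbf{P}$.) A proper thick two-sided ideal $\mathbf{P}$ is completely prime if for all objects $A, B$ of $\mathbf{K}$, $A \otimes B \in \mathbf{P}$ implies $A \in \mathbf{P}$ or $B \in \mathbf{P}$. The noncommutative Balmer spectrum $\operatorname{Spc} \mathbf{K}$ is the set of prime ideals of $\mathbf{K}$, with the topology generated by the closed sets $V(M) = \{ \mathbf{P} \in \operatorname{Spc} \mathbf{K} \mid M \notin \mathbf{P}\}$, $M \in \mathbf{K}$. The universal support datum is the map $M \mapsto V(M)$. $\mathcal{X}(Y)$ denotes the collection of all subsets of $Y$. *)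

(* Defs.v *)
From HB Require Import structures.
From mathcomp Require Import all_boot all_algebra.
From mathcomp Require Import boolp classical_sets topology.

Set Implicit Arguments.
Unset Strict Implicit.
Unset Printing Implicit Defensive.

Import GRing.Theory.
Local Open Scope ring_scope.
Local Open Scope classical_set_scope.

Declare Scope cat_scope.
Delimit Scope cat_scope with cat.
Local Open Scope cat_scope.

Reserved Notation "g ∘ f" (at level 40, left associativity).
Reserved Notation "A ≅ B" (at level 70, no associativity).
Reserved Notation "A ⊗ B" (at level 40, left associativity).
Reserved Notation "f ⊗m g" (at level 40, left associativity).

Record preadditive := Preadditive {
  obj :> Type;
  hom : obj -> obj -> zmodType;
  idm : forall A, hom A A;
  comp : forall A B C, hom B C -> hom A B -> hom A C;
  comp1m : forall A B (f : hom A B), comp (idm B) f = f;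
  compm1 : forall A B (f : hom A B), comp f (idm A) = f;
  compA : forall A B C D (h : hom C D) (g : hom B C) (f : hom A B),
    comp h (comp g f) = comp (comp h g) f;
  compDl : forall A B C (g g' : hom B C) (f : hom A B),
    comp (g + g') f = comp g f + comp g' f;
  compDr : forall A B C (g : hom B C) (f f' : hom A B),
    comp g (f + f') = comp g f + comp g f' }.

Arguments hom {p} A B.
Arguments idm {p} A.
Notation "g ∘ f" := (comp g f) : cat_scope.

Section Preadditive.
Variable C : preadditive.

Definition is_iso (A B : C) (f : hom A B) : Prop :=
  exists g : hom B A, g ∘ f = idm A /\ f ∘ g = idm B.

Definition isomorphic (A B : C) : Prop := exists f : hom A B, is_iso f.

Definition is_zero_object (Z : C) : Prop :=
  forall A : C, (forall f : hom A Z, f = 0) /\ (forall f : hom Z A, f = 0).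

Definition is_biproduct (A B S : C) (iA : hom A S) (iB : hom B S)
    (pA : hom S A) (pB : hom S B) : Prop :=
  [/\ pA ∘ iA = idm A, pB ∘ iB = idm B, pA ∘ iB = 0, pB ∘ iA = 0
    & iA ∘ pA + iB ∘ pB = idm S].

(* [S] is a direct sum of [A] and [B]; this determines [S] up to isomorphism *)
Definition direct_sum (A B S : C) : Prop :=
  exists (iA : hom A S) (iB : hom B S) (pA : hom S A) (pB : hom S B),
    is_biproduct iA iB pA pB.

Definition direct_summand (A S : C) : Prop := exists B : C, direct_sum A B S.

End Preadditive.

Notation "A ≅ B" := (isomorphic A B) : cat_scope.

Record additive_category := AdditiveCategory {
  additive_base :> preadditive;
  zero_obj : additive_base;
  zero_objP : is_zero_object zero_obj;
  direct_sumP : forall A B : additive_base, exists S, direct_sum A B S }.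

Arguments zero_obj {a}.

Record functor (C D : preadditive) := Functor {
  fobj :> C -> D;
  fmap : forall A B : C, hom A B -> hom (fobj A) (fobj B);
  fmap1 : forall A : C, fmap (idm A) = idm (fobj A);
  fmapM : forall (A B E : C) (g : hom B E) (f : hom A B),
    fmap (g ∘ f) = fmap g ∘ fmap f }.

Arguments fmap {C D} F {A B} f : rename.

Definition additive_functor (C D : preadditive) (F : functor C D) : Prop :=
  forall (A B : C) (f g : hom A B), fmap F (f + g) = fmap F f + fmap F g.

Definition equivalence (C D : preadditive) (F : functor C D) : Prop :=
  (forall A B : C, bijective (@fmap C D F A B)) /\
  (forall X : D, exists A : C, F A ≅ X).

(* The shift is an autoequivalence, not necessarily an automorphism.
   [dist f g h] says that A -f-> B -g-> C -h-> shift A is distinguished. *)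
Record triangulated := Triangulated {
  tri_base :> additive_category;
  shift : functor tri_base tri_base;
  shift_additive : additive_functor shift;
  shift_equiv : equivalence shift;
  dist : forall A B C : tri_base,
    hom A B -> hom B C -> hom C (shift A) -> Prop;
  dist_iso : forall (A B C A' B' C' : tri_base)
    (f : hom A B) (g : hom B C) (h : hom C (shift A))
    (f' : hom A' B') (g' : hom B' C') (h' : hom C' (shift A'))
    (a : hom A A') (b : hom B B') (c : hom C C'),
    is_iso a -> is_iso b -> is_iso c ->
    b ∘ f = f' ∘ a -> c ∘ g = g' ∘ b -> fmap shift a ∘ h = h' ∘ c ->
    dist f g h -> dist f' g' h';
  dist_id : forall A : tri_base,
    dist (idm A) (0 : hom A zero_obj) (0 : hom zero_obj (shift A));
  dist_cone : forall (A B : tri_base) (f : hom A B),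
    exists (C : tri_base) (g : hom B C) (h : hom C (shift A)), dist f g h;
  dist_rot : forall (A B C : tri_base)
    (f : hom A B) (g : hom B C) (h : hom C (shift A)),
    dist f g h <-> dist g h (- fmap shift f);
  dist_fill : forall (A B C A' B' C' : tri_base)
    (f : hom A B) (g : hom B C) (h : hom C (shift A))
    (f' : hom A' B') (g' : hom B' C') (h' : hom C' (shift A'))
    (a : hom A A') (b : hom B B'),
    dist f g h -> dist f' g' h' -> b ∘ f = f' ∘ a ->
    exists c : hom C C', c ∘ g = g' ∘ b /\ fmap shift a ∘ h = h' ∘ c;
  (* the octahedral axiom, with Z', Y', X' the cones of f, g ∘ f, g *)
  dist_octahedron : forall (X Y Z X' Y' Z' : tri_base)
    (f : hom X Y) (u : hom Y Z') (a : hom Z' (shift X))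
    (g : hom Y Z) (v : hom Z X') (b : hom X' (shift Y))
    (w : hom Z Y') (c : hom Y' (shift X)),
    dist f u a -> dist g v b -> dist (g ∘ f) w c ->
    exists (s : hom Z' Y') (t : hom Y' X'),
      [/\ dist s t (fmap shift u ∘ b),
          s ∘ u = w ∘ g, c ∘ s = a, t ∘ w = v
        & b ∘ t = fmap shift f ∘ c] }.

Arguments shift {t}.
Arguments dist {t A B C} f g h.

Definition exact_functor (T T' : triangulated) (F : functor T T') : Prop :=
  additive_functor F /\
  exists phi : forall A : T, hom (F (shift A)) (shift (F A)),
    [/\ forall A, is_iso (phi A),
        forall (A B : T) (f : hom A B),
          phi B ∘ fmap F (fmap shift f) = fmap shift (fmap F f) ∘ phi A
      & forall (A B C : T) (f : hom A B) (g : hom B C) (h : hom C (shift A)),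
          dist f g h -> dist (fmap F f) (fmap F g) (phi A ∘ fmap F h)].

Record monoidal (C : preadditive) := Monoidal {
  mtens : C -> C -> C;
  mmap : forall A A' B B' : C,
    hom A A' -> hom B B' -> hom (mtens A B) (mtens A' B');
  mmap1 : forall A B, mmap (idm A) (idm B) = idm (mtens A B);
  mmapM : forall (A A' A'' B B' B'' : C) (f' : hom A' A'') (f : hom A A')
    (g' : hom B' B'') (g : hom B B'),
    mmap (f' ∘ f) (g' ∘ g) = mmap f' g' ∘ mmap f g;
  munit : C;
  massoc : forall A B D : C,
    hom (mtens (mtens A B) D) (mtens A (mtens B D));
  massocV : forall A B D : C,
    hom (mtens A (mtens B D)) (mtens (mtens A B) D);
  massocK : forall A B D, massocV A B D ∘ massoc A B D = idm _;
  massocVK : forall A B D, massoc A B D ∘ massocV A B D = idm _;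
  massoc_nat : forall (A A' B B' D D' : C)
    (f : hom A A') (g : hom B B') (h : hom D D'),
    massoc A' B' D' ∘ mmap (mmap f g) h = mmap f (mmap g h) ∘ massoc A B D;
  mlunit : forall A : C, hom (mtens munit A) A;
  mlunitV : forall A : C, hom A (mtens munit A);
  mlunitK : forall A, mlunitV A ∘ mlunit A = idm _;
  mlunitVK : forall A, mlunit A ∘ mlunitV A = idm _;
  mlunit_nat : forall (A A' : C) (f : hom A A'),
    mlunit A' ∘ mmap (idm munit) f = f ∘ mlunit A;
  mrunit : forall A : C, hom (mtens A munit) A;
  mrunitV : forall A : C, hom A (mtens A munit);
  mrunitK : forall A, mrunitV A ∘ mrunit A = idm _;
  mrunitVK : forall A, mrunit A ∘ mrunitV A = idm _;
  mrunit_nat : forall (A A' : C) (f : hom A A'),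
    mrunit A' ∘ mmap f (idm munit) = f ∘ mrunit A;
  mpentagon : forall A B D E : C,
    mmap (idm A) (massoc B D E) ∘ massoc A (mtens B D) E
      ∘ mmap (massoc A B D) (idm E)
    = massoc A B (mtens D E) ∘ massoc (mtens A B) D E;
  mtriangle : forall A B : C,
    mmap (idm A) (mlunit B) ∘ massoc A munit B = mmap (mrunit A) (idm B) }.

Section TensorFunctors.
Variables (C : preadditive) (m : monoidal C) (A : C).

Lemma tensl_map1 (B : C) : mmap m (idm A) (idm B) = idm (mtens m A B).
Proof. exact: mmap1. Qed.

Lemma tensl_mapM (B B' B'' : C) (g : hom B' B'') (f : hom B B') :
  mmap m (idm A) (g ∘ f) = mmap m (idm A) g ∘ mmap m (idm A) f.
Proof. by rewrite -mmapM comp1m. Qed.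

Lemma tensr_map1 (B : C) : mmap m (idm B) (idm A) = idm (mtens m B A).
Proof. exact: mmap1. Qed.

Lemma tensr_mapM (B B' B'' : C) (g : hom B' B'') (f : hom B B') :
  mmap m (g ∘ f) (idm A) = mmap m g (idm A) ∘ mmap m f (idm A).
Proof. by rewrite -mmapM comp1m. Qed.

Definition tensl : functor C C :=
  @Functor C C (fun B => mtens m A B) (fun B B' f => mmap m (idm A) f)
    tensl_map1 tensl_mapM.

Definition tensr : functor C C :=
  @Functor C C (fun B => mtens m B A) (fun B B' f => mmap m f (idm A))
    tensr_map1 tensr_mapM.

End TensorFunctors.

(* "Exact bifunctor" means exact in each variable separately; the shift
   isomorphisms of the two variables are not required to be compatible. *)
Record monoidal_triangulated := MonoidalTriangulated {
  mt_base :> triangulated;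
  mt_monoidal : monoidal mt_base;
  tensl_exact : forall A : mt_base,
    @exact_functor mt_base mt_base (tensl mt_monoidal A);
  tensr_exact : forall A : mt_base,
    @exact_functor mt_base mt_base (tensr mt_monoidal A) }.

Section MonoidalTriangulated.
Variable K : monoidal_triangulated.

Definition tens : K -> K -> K := mtens (mt_monoidal K).
Definition tmap (A A' B B' : K) (f : hom A A') (g : hom B B') :
  hom (tens A B) (tens A' B') := mmap (mt_monoidal K) f g.
Definition unit_obj : K := munit (mt_monoidal K).
Definition assoc (A B C : K) : hom (tens (tens A B) C) (tens A (tens B C)) :=
  massoc (mt_monoidal K) A B C.
Definition assocV (A B C : K) : hom (tens A (tens B C)) (tens (tens A B) C) :=
  massocV (mt_monoidal K) A B C.
Definition lunit (A : K) : hom (tens unit_obj A) A := mlunit (mt_monoidal K) A.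
Definition lunitV (A : K) : hom A (tens unit_obj A) := mlunitV (mt_monoidal K) A.
Definition runit (A : K) : hom (tens A unit_obj) A := mrunit (mt_monoidal K) A.
Definition runitV (A : K) : hom A (tens A unit_obj) := mrunitV (mt_monoidal K) A.

Local Notation "A ⊗ B" := (tens A B) : cat_scope.
Local Notation "f ⊗m g" := (tmap f g) : cat_scope.

Definition is_duality (D A : K) (ev : hom (D ⊗ A) unit_obj) (coev : hom unit_obj (A ⊗ D))
    : Prop :=
  runit A ∘ (idm A ⊗m ev) ∘ assoc A D A ∘ (coev ⊗m idm A) ∘ lunitV A = idm A /\
  lunit D ∘ (ev ⊗m idm D) ∘ assocV D A D ∘ (idm D ⊗m coev) ∘ runitV D = idm D.

Definition left_dualizable (A : K) : Prop :=
  exists (D : K) (ev : hom (D ⊗ A) unit_obj) (coev : hom unit_obj (A ⊗ D)),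
    is_duality ev coev.

Definition right_dualizable (A : K) : Prop :=
  exists (D : K) (ev : hom (A ⊗ D) unit_obj) (coev : hom unit_obj (D ⊗ A)),
    is_duality ev coev.

(* left-bracketed power: [tpow M 1] is [M], [tpow M 3] is [(M ⊗ M) ⊗ M] *)
Definition tpow (M : K) (n : nat) : K :=
  if n is n'.+1 then iter n' (fun X => X ⊗ M) M else unit_obj.

(* A full subcategory is given by its set of objects. *)
Definition triangulated_subcategory (I : set K) : Prop :=
  [/\ I zero_obj,
      forall A : K, I (shift A) <-> I A
    & forall (A B C : K) (f : hom A B) (g : hom B C) (h : hom C (shift A)),
        dist f g h -> I A -> I B -> I C].

(* Closure under direct summands includes closure under isomorphism. *)
Definition thick_subcategory (I : set K) : Prop :=
  triangulated_subcategory I /\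
  (forall A B : K, direct_summand A B -> I B -> I A).

Definition thick_ideal (I : set K) : Prop :=
  thick_subcategory I /\ (forall A B : K, I A -> I (A ⊗ B) /\ I (B ⊗ A)).

Definition proper_thick_ideal (I : set K) : Prop :=
  thick_ideal I /\ I <> setT.

Definition tens_set (I J : set K) : set K := [set A ⊗ B | A in I & B in J].

Definition prime_ideal (P : set K) : Prop :=
  proper_thick_ideal P /\
  (forall I J : set K, thick_ideal I -> thick_ideal J ->
    tens_set I J `<=` P -> I `<=` P \/ J `<=` P).

Definition completely_prime (P : set K) : Prop :=
  proper_thick_ideal P /\ (forall A B : K, P (A ⊗ B) -> P A \/ P B).

Record Spc := MkSpc { spc_ideal : set K; spc_prime : prime_ideal spc_ideal }.

Definition universal_support (M : K) : set Spc := [set P : Spc | ~ spc_ideal P M].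

Definition tensor_product_property (Y : Type) (sigma : K -> set Y) : Prop :=
  forall A B : K, sigma (A ⊗ B) = sigma A `&` sigma B.

End MonoidalTriangulated.

Notation "A ⊗ B" := (tens A B) : cat_scope.
Notation "f ⊗m g" := (tmap f g) : cat_scope.

HB.instance Definition _ (K : monoidal_triangulated) := gen_eqMixin (Spc K).
HB.instance Definition _ (K : monoidal_triangulated) :=
  gen_choiceMixin (Spc K).

(* the coarsest topology for which the sets [universal_support M] are closed *)
HB.instance Definition _ (K : monoidal_triangulated) :=
  isSubBaseTopological.Build (Spc K)
    (range (fun M : K => ~` universal_support M)) id.

(* Main.v *)
Require Import Defs.
From mathcomp Require Import all_boot all_algebra.
From mathcomp Require Import boolp classical_sets topology.

Local Open Scope cat_scope.

(** Once [M] is non-zero, some prime ideal [P] misses [M]; this is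
    [exists_prime_avoiding] applied to the ideal of zero objects.  If [P] were
    completely prime, then [P], which contains the zero object [tpow M n],
    would contain [M].  The tensor product property of the universal support
    says exactly that every prime ideal is completely prime, so it fails too.

    The prime is obtained as in commutative algebra: by Zorn's lemma there is a
    thick ideal [P] maximal among those missing [M].  Suppose that
    [I ⊗ J ⊆ P] with neither [I] nor [J] contained in [P].  The left annihilator
    [I'] of [J] modulo [P] is a thick ideal containing [P] and [I], so it
    contains [M] by maximality; the right annihilator of [I'] modulo [P]
    contains [P] and [J], so it contains [M] as well
    ([prime_of_maximal_avoiding]).  As [M ⊗ D] lies in [I'],
    the object [(M ⊗ D) ⊗ M] lies in [P] for every [D].  Here dualizability
    enters: when [D] is a dual of [M], the triangle identity makes [M] a retract
    of [(M ⊗ D) ⊗ M], and in a triangulated category a retract is a direct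
    summand ([retract_direct_summand]), so [M] lies in [P], a contradiction.
    Annihilators are thick because they are intersections of preimages of [P]
    under the exact functors [X ⊗ -] and [- ⊗ Y]. *)

Set Implicit Arguments.
Unset Strict Implicit.
Unset Printing Implicit Defensive.

Import GRing.Theory.
Local Open Scope ring_scope.
Local Open Scope classical_set_scope.

Local Notation hom := Defs.hom.
Local Notation fmap := Defs.fmap.
Local Notation shift := Defs.shift.
Local Notation compA := Defs.compA.

(** * Zero objects and additive functors *)

Section Preadditive.
Variable C : preadditive.

Lemma comp0m (A B D : C) (f : hom A B) : (0 : hom B D) ∘ f = 0.
Proof. by apply: (addrI (0 ∘ f)); rewrite -compDl !addr0. Qed.

Lemma compm0 (A B D : C) (g : hom B D) : g ∘ (0 : hom A B) = 0.
Proof. by apply: (addrI (g ∘ 0)); rewrite -compDr !addr0. Qed.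

Lemma compNm (A B D : C) (g : hom B D) (f : hom A B) : (- g) ∘ f = - (g ∘ f).
Proof. by apply: (addrI (g ∘ f)); rewrite -compDl !subrr comp0m. Qed.

Lemma compmN (A B D : C) (g : hom B D) (f : hom A B) : g ∘ (- f) = - (g ∘ f).
Proof. by apply: (addrI (g ∘ f)); rewrite -compDr !subrr compm0. Qed.

(** Every morphism into or out of [A] factors through [idm A]. *)
Lemma is_zero_objectP (A : C) : is_zero_object A <-> idm A = 0.
Proof.
split=> [zA|id0 B]; first by case: (zA A).
split=> f; first by rewrite -(comp1m f) id0 comp0m.
by rewrite -(compm1 f) id0 compm0.
Qed.

Lemma isomorphic_sym (A B : C) : A ≅ B -> B ≅ A.
Proof. by move=> [f [g [gf fg]]]; exists g, f. Qed.

Lemma is_zero_object_iso (A B : C) :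
  A ≅ B -> is_zero_object B -> is_zero_object A.
Proof.
move=> [f [g [gf _]]] zB; apply/is_zero_objectP.
by rewrite -gf ((zB A).1 f) compm0.
Qed.

Lemma zero_objects_isomorphic (A B : C) :
  is_zero_object A -> is_zero_object B -> A ≅ B.
Proof.
move=> zA zB; exists 0; exists 0; rewrite !comp0m.
by split; apply/esym/is_zero_objectP.
Qed.

Lemma direct_sum_zero (A B Z : C) :
  is_zero_object Z -> A ≅ B -> direct_sum A Z B.
Proof.
move=> zZ [f [g [gf fg]]]; exists f, 0, g, 0.
by split; rewrite ?comp0m ?compm0 ?addr0 //; apply/esym/is_zero_objectP.
Qed.

End Preadditive.

Section AdditiveFunctor.
Variables (C D : preadditive) (F : functor C D).
Hypothesis addF : additive_functor F.

Lemma fmap0 (A B : C) : fmap F (0 : hom A B) = 0.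
Proof. by apply: (addrI (fmap F 0)); rewrite -addF !addr0. Qed.

Lemma fmap_zero_object (A : C) : is_zero_object A -> is_zero_object (F A).
Proof.
move=> /is_zero_objectP id0; apply/is_zero_objectP.
by rewrite -fmap1 id0 fmap0.
Qed.

Lemma fmap_direct_summand (A S : C) :
  direct_summand A S -> direct_summand (F A) (F S).
Proof.
move=> [B [iA [iB [pA [pB [AA BB AB BA sum]]]]]]; exists (F B).
exists (fmap F iA), (fmap F iB), (fmap F pA), (fmap F pB).
by split; rewrite -!fmapM ?AA ?BB ?AB ?BA -?addF ?sum ?fmap0 ?fmap1.
Qed.

End AdditiveFunctor.

(** * Triangles and retracts *)

Section Triangulated.
Variable T : triangulated.

Lemma shift_inj (A B : T) : injective (@fmap T T shift A B).
Proof. exact: bij_inj ((shift_equiv T).1 A B). Qed.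

Lemma is_zero_object_shift (A : T) :
  is_zero_object (shift A) <-> is_zero_object A.
Proof.
split; last exact: fmap_zero_object (@shift_additive T) _.
move=> /is_zero_objectP id0; apply/is_zero_objectP/shift_inj.
by rewrite fmap1 id0 (fmap0 (@shift_additive T)).
Qed.

(** The identity triangle on [A] maps to the given one by [(idm A, f)]; the
    third component starts at the zero object. *)
Lemma dist_comp0 (A B C : T) (f : hom A B) (g : hom B C)
  (h : hom C (shift A)) : dist f g h -> g ∘ f = 0.
Proof.
move=> dfgh.
have [c [<- _]] := dist_fill (a := idm A) (b := f) (dist_id A) dfgh erefl.
exact: compm0.
Qed.

(** This half of the exactness of [hom X -] comes from filling a map from the
    rotated identity triangle of [X] to the rotated given one; the map found
    lives after a shift, which is full and faithful. *)
Lemma dist_weak_kernel (A B C X : T) (f : hom A B) (g : hom B C)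
  (h : hom C (shift A)) (x : hom X B) :
  dist f g h -> g ∘ x = 0 -> exists y : hom X A, f ∘ y = x.
Proof.
move=> /dist_rot dgh gx0.
have /dist_rot dX := dist_id X.
have sq : (0 : hom zero_obj C) ∘ (0 : hom X zero_obj) = g ∘ x.
  by rewrite gx0 comp0m.
have [c [_]] := dist_fill dX dgh sq.
have [s _ sK] := (shift_equiv T).1 X A.
rewrite fmap1 compmN compm1 compNm -[c]sK -fmapM => /oppr_inj /shift_inj.
by exists (s c).
Qed.

(** The identity of [C] is killed by [h], whose target is zero, so it factors
    through [B]. *)
Lemma dist_zero_object (A B C : T) (f : hom A B) (g : hom B C)
  (h : hom C (shift A)) :
  dist f g h -> is_zero_object A -> is_zero_object B -> is_zero_object C.
Proof.
move=> /dist_rot dgh /is_zero_object_shift zA zB; apply/is_zero_objectP.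
have [|y <-] := dist_weak_kernel (x := idm C) dgh; first exact: (zA C).1.
by rewrite ((zB C).2 g) comp0m.
Qed.

(** The complement is the cone [C] of [i].  Since [i] is split mono, the
    boundary [h] of [C] vanishes, so [g : S -> C] has a section, which is then
    corrected by [p] to be orthogonal to it. *)
Lemma retract_direct_summand (A S : T) (i : hom A S) (p : hom S A) :
  p ∘ i = idm A -> direct_summand A S.
Proof.
move=> pi; have [C [g [h dig]]] := dist_cone i; exists C.
have gi := dist_comp0 dig; have /dist_rot dgh := dig.
have ih : fmap shift i ∘ h = 0.
  move/dist_rot: (dgh) => /dist_comp0; rewrite compNm => /eqP.
  by rewrite oppr_eq0 => /eqP.
have h0 : h = 0.
  by rewrite -(comp1m h) -fmap1 -pi fmapM -compA ih compm0.
have [|s gs] := dist_weak_kernel (x := idm C) dgh.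
  by rewrite h0 comp0m.
pose t := s - i ∘ (p ∘ s).
have gt : g ∘ t = idm C by rewrite compDr compmN compA gi comp0m subr0.
have pt : p ∘ t = 0 by rewrite compDr compmN compA pi comp1m subrr.
exists i, t, p, g; split=> //.
pose e := idm S - (i ∘ p + t ∘ g).
have ge : g ∘ e = 0.
  by rewrite compDr compmN compDr !compA gi gt comp0m comp1m compm1 add0r subrr.
have pe : p ∘ e = 0.
  by rewrite compDr compmN compDr !compA pi pt comp0m comp1m compm1 addr0 subrr.
have [y ey] := dist_weak_kernel dig ge.
apply/esym/eqP; rewrite -subr_eq0 -/e -ey -(comp1m y) -pi -compA ey pe.
by rewrite compm0.
Qed.

End Triangulated.

(** * Thick subcategories *)

Section ThickSubcategory.
Variable K : monoidal_triangulated.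
Implicit Types (I : set K) (A B : K).

Lemma thick_iso I A B : thick_subcategory I -> A ≅ B -> I B -> I A.
Proof.
move=> [_ sumI] AB; apply: sumI; exists zero_obj.
by apply: direct_sum_zero AB; exact: zero_objP.
Qed.

Lemma thick_zero_object I A : thick_subcategory I -> is_zero_object A -> I A.
Proof.
move=> thI zA; have [[I0 _ _] _] := thI.
by apply: thick_iso I0 => //; exact: zero_objects_isomorphic zA (@zero_objP K).
Qed.

Lemma thick_zero_objects : thick_subcategory [set A : K | is_zero_object A].
Proof.
split; first split=> /=.
- exact: zero_objP.
- by move=> A; exact: is_zero_object_shift.
- by move=> A B C f g h; exact: dist_zero_object.
move=> A S [B [iA [iB [pA [pB [AA _ _ _ _]]]]]] /= zS.
by apply/is_zero_objectP; rewrite -AA ((zS A).1 iA) compm0.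
Qed.

Lemma thick_bigcap (J : Type) (D : set J) (F : J -> set K) :
  (forall j, D j -> thick_subcategory (F j)) ->
  thick_subcategory (\bigcap_(j in D) F j).
Proof.
move=> thF; split; first split.
- by move=> j /thF [[]].
- move=> A; split=> IA j Dj; have [[_ sh _] _] := thF j Dj; apply/sh; exact: IA.
- move=> A B C f g h dfgh IA IB j Dj; have [[_ _ tri] _] := thF j Dj.
  by apply: tri dfgh _ _; [exact: IA | exact: IB].
- move=> A S AS IS j Dj; have [_ sumF] := thF j Dj.
  by apply: sumF AS _; exact: IS.
Qed.

(** The isomorphisms [F (shift A) ≅ shift (F A)] carry triangles and shifts over
    to [F], since thick subcategories are closed under isomorphism. *)
Lemma thick_preimage (F : functor K K) I :
  exact_functor F -> thick_subcategory I -> thick_subcategory [set A | I (F A)].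
Proof.
move=> [addF [phi [phi_iso _ phi_dist]]] thI; have [[_ shI triI] sumI] := thI.
have phiF A : F (shift A) ≅ shift (F A) by exists (phi A).
split; first split=> /=.
- by apply: thick_zero_object => //; apply: fmap_zero_object => //; exact: zero_objP.
- move=> A; split=> [IA|/shI IA]; last exact: thick_iso (phiF A) IA.
  by apply/shI; exact: thick_iso (isomorphic_sym (phiF A)) IA.
- by move=> A B C f g h /phi_dist; exact: triI.
- by move=> A S /(fmap_direct_summand addF); exact: sumI.
Qed.

End ThickSubcategory.

(** * Thick ideals and residuals *)

Section ThickIdeal.
Variable K : monoidal_triangulated.
Implicit Types (I J P : set K) (A B D M X Y : K).

Lemma tens_assoc A B D : (A ⊗ B) ⊗ D ≅ A ⊗ (B ⊗ D).
Proof.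
by exists (assoc A B D), (assocV A B D); split; [exact: massocK | exact: massocVK].
Qed.

Lemma thick_ideal_zero_objects : thick_ideal [set A : K | is_zero_object A].
Proof.
split=> [|A B /= zA]; first exact: thick_zero_objects.
split; first exact: fmap_zero_object (tensr_exact B).1 _ zA.
exact: fmap_zero_object (tensl_exact B).1 _ zA.
Qed.

(** Each closure condition on a thick ideal has at most two membership
    hypotheses, and two members of a chain of sets lie in a common one. *)
Lemma thick_ideal_chain (F : set (set K)) :
  F !=set0 -> total_on F subset -> F `<=` @thick_ideal K ->
  thick_ideal (\bigcup_(I in F) I).
Proof.
move=> [I0 FI0] totF thF; split; first split; first split.
- by exists I0 => //; have [[[]]] := thF _ FI0.
- by move=> A; split=> -[I FI IA]; exists I => //;
    have [[[_ sh _] _] _] := thF _ FI; apply/sh.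
- move=> A B C f g h dfgh [I FI IA] [J FJ JB].
  have [IJ|JI] := totF _ _ FI FJ.
    exists J => //; have [[[_ _ tri] _] _] := thF _ FJ.
    by apply: tri dfgh _ _ => //; exact: IJ.
  exists I => //; have [[[_ _ tri] _] _] := thF _ FI.
  by apply: tri dfgh _ _ => //; exact: JI.
- move=> A S AS [I FI IS]; exists I => //.
  by have [[_ sumI] _] := thF _ FI; exact: sumI AS IS.
- move=> A B [I FI IA]; have [_ tensI] := thF _ FI.
  by have [] := tensI A B IA; split; exists I.
Qed.

(** The residuals of [P] by [J], that is, the left and the right annihilator of
    [J] in the quotient of [K] by [P]. *)
Definition left_residual P J : set K := [set X | forall Y, J Y -> P (X ⊗ Y)].
Definition right_residual P J : set K := [set Y | forall X, J X -> P (X ⊗ Y)].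

(** Closure under right tensoring uses that [J] absorbs on the left, since
    [(X ⊗ B) ⊗ Y] is [X ⊗ (B ⊗ Y)]. *)
Lemma thick_ideal_left_residual P J :
  thick_ideal P -> thick_ideal J -> thick_ideal (left_residual P J).
Proof.
move=> [thP tensP] [_ tensJ]; split.
  apply: (@thick_bigcap _ K J (fun Y => [set X | P (X ⊗ Y)])) => Y _.
  exact: (thick_preimage (tensr_exact Y) thP).
move=> X B resX; split=> Y JY.
  by apply: thick_iso (tens_assoc _ _ _) _ => //; apply: resX; have [] := tensJ Y B JY.
apply: thick_iso (tens_assoc _ _ _) _ => //.
by have [] := tensP _ B (resX Y JY).
Qed.

Lemma thick_ideal_right_residual P J :
  thick_ideal P -> thick_ideal J -> thick_ideal (right_residual P J).
Proof.
move=> [thP tensP] [_ tensJ]; split.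
  apply: (@thick_bigcap _ K J (fun X => [set Y | P (X ⊗ Y)])) => X _.
  exact: (thick_preimage (tensl_exact X) thP).
move=> Y B resY; split=> X JX.
  apply: thick_iso (isomorphic_sym (tens_assoc _ _ _)) _ => //.
  by have [] := tensP _ B (resY X JX).
apply: thick_iso (isomorphic_sym (tens_assoc _ _ _)) _ => //.
by apply: resY; have [] := tensJ X B JX.
Qed.

(** Up to bracketing, a triangle identity for [M] factors the identity of [M]
    through [M ⊗ D ⊗ M]; left and right duals give the same conclusion. *)
Lemma dualizable_direct_summand M :
  left_dualizable M \/ right_dualizable M ->
  exists D, direct_summand M ((M ⊗ D) ⊗ M).
Proof.
move=> [] [D [ev [coev [zig zag]]]]; exists D.
  apply: (@retract_direct_summand _ _ _ ((coev ⊗m idm M) ∘ lunitV M)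
    (runit M ∘ (idm M ⊗m ev) ∘ assoc M D M)).
  by rewrite compA.
apply: (@retract_direct_summand _ _ _
  (assocV M D M ∘ (idm M ⊗m coev) ∘ runitV M) (lunit M ∘ (ev ⊗m idm M))).
by rewrite !compA.
Qed.

(** * Prime ideals avoiding an object *)

(** Taking the second residual with respect to the first, rather than with
    respect to [I], is what makes every [(M ⊗ D) ⊗ M], and not only the products
    of members of [I] with [M], land in [P]. *)
Lemma prime_of_maximal_avoiding P M :
  left_dualizable M \/ right_dualizable M ->
  thick_ideal P -> ~ P M ->
  (forall I, thick_ideal I -> P `<=` I -> ~ I M -> I `<=` P) -> prime_ideal P.
Proof.
move=> dualM idP PM maxP.
have M_in I : thick_ideal I -> P `<=` I -> ~ (I `<=` P) -> I M.
  by move=> idI PI nIP; apply: contrapT => nIM; exact: nIP (maxP I idI PI nIM).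
split; first by split=> // PT; apply: PM; rewrite PT.
move=> I J idI idJ IJP; apply: contrapT => /not_orP [nIP nJP].
pose I' := left_residual P J; pose J' := right_residual P I'.
have idI' : thick_ideal I' by exact: thick_ideal_left_residual.
have idJ' : thick_ideal J' by exact: thick_ideal_right_residual.
have I'M : I' M.
  apply: M_in => // [X PX Y _|I'P]; first by have [_ /(_ X Y PX) []] := idP.
  by apply: nIP => X IX; apply: I'P => Y JY; apply: IJP; exists X => //; exists Y.
have J'M : J' M.
  apply: M_in => // [Y PY X _|J'P]; first by have [_ /(_ Y X PY) []] := idP.
  by apply: nJP => Y JY; apply: J'P => X; apply.
have [D sumM] := dualizable_direct_summand dualM.
apply: PM; have [[_ sumP] _] := idP; apply: sumP sumM _; apply: J'M.
by have [_ /(_ M D I'M) []] := idI'.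
Qed.

Lemma exists_prime_avoiding I M :
  left_dualizable M \/ right_dualizable M ->
  thick_ideal I -> ~ I M ->
  exists P, [/\ prime_ideal P, I `<=` P & ~ P M].
Proof.
move=> dualM idI nIM.
(* The union of the empty chain is the empty set, which is not an ideal; testing
   [I `|` X] instead of [X] makes [I] the ideal that bounds this chain. *)
pose good (X : set K) := thick_ideal (I `|` X) /\ ~ (I `|` X) M.
have [F goodF totF|X [[idX nXM] maxX]] := @Zorn_bigcup K good.
  pose G : set (set K) := [set I `|` X | X in set0 |` F].
  have -> : good (\bigcup_(X in F) X) =
      (thick_ideal (\bigcup_(Y in G) Y) /\ ~ (\bigcup_(Y in G) Y) M).
    rewrite /good; suff -> : I `|` \bigcup_(X in F) X = \bigcup_(Y in G) Y by [].
    rewrite predeqE => A; split=> [[IA|[X FX XA]]|[_ [X FX <-] [IA|XA]]].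
    - by exists (I `|` set0); [exists set0 => //; left | left].
    - by exists (I `|` X); [exists X => //; right | right].
    - by left.
    - by case: FX XA => [-> []|FX XA]; right; exists X.
  have goodG (X : set K) : (set0 |` F) X -> good X.
    by move=> [->|/goodF //]; rewrite /good setU0.
  split; last by move=> [_ [X /goodG [_ nXM] <-]].
  apply: thick_ideal_chain; first by exists (I `|` set0), set0 => //; left.
    move=> _ _ [X FX <-] [Y FY <-].
    suff [XY|YX] : X `<=` Y \/ Y `<=` X by [left; exact: setUS|right; exact: setUS].
    case: FX => [->|FX]; first by left.
    by case: FY => [->|FY]; [right | exact: totF].
  by move=> _ [X /goodG [idX _] <-].
exists (I `|` X); split=> //.
apply: prime_of_maximal_avoiding nXM _ => // J idJ IXJ nJM Y JY.
apply: contrapT => nY; apply: (maxX J).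
  split=> [Z XZ|JX]; first by apply: IXJ; right.
  by apply: nY; right; exact: JX.
have IJ : I `|` J = J by apply/setUidPr => Z IZ; apply: IXJ; left.
by rewrite /good IJ.
Qed.

End ThickIdeal.

(** * Nilpotent objects *)

Lemma tpow_completely_prime (K : monoidal_triangulated) (P : set K) (M : K) n :
  completely_prime P -> (0 < n)%N -> P (tpow M n) -> P M.
Proof.
by move=> [_ cpP]; case: n => // n _; elim: n => //= n IHn /cpP [].
Qed.

Lemma completely_prime_of_tensor_product_property (K : monoidal_triangulated) :
  tensor_product_property (@universal_support K) ->
  forall P : set K, prime_ideal P -> completely_prime P.
Proof.
move=> tpp P primeP; split=> [|A B PAB]; first by case: primeP.
apply: contrapT => /not_orP [nPA nPB].
have : (universal_support A `&` universal_support B) (MkSpc primeP) by [].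
by rewrite -tpp; apply.
Qed.

Theorem theorem4p2p1 (K : monoidal_triangulated)
  (dualK : forall A : K, left_dualizable A \/ right_dualizable A)
  (M : K) (M_nonzero : ~ (M ≅ zero_obj))
  (M_nilpotent : exists n : nat, (0 < n)%N /\ tpow M n ≅ zero_obj) :
  ~ (forall P : set K, prime_ideal P -> completely_prime P) /\
  ~ tensor_product_property (@universal_support K).
Proof.
have notcp : ~ (forall P : set K, prime_ideal P -> completely_prime P).
  move=> cp; have [n [n_gt0 Mn0]] := M_nilpotent.
  have [|P [primeP _ nPM]] :=
      @exists_prime_avoiding K _ M (dualK M) (@thick_ideal_zero_objects K).
    by move=> zM; apply: M_nonzero; exact: zero_objects_isomorphic zM (@zero_objP K).
  apply: nPM; apply: tpow_completely_prime (cp P primeP) n_gt0 _.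
  have [[[thP _] _] _] := primeP.
  apply: thick_zero_object thP _.
  exact: is_zero_object_iso Mn0 (@zero_objP K).
by split=> // /completely_prime_of_tensor_product_property.
Qed.
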